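(* Let $n\ge2$, $I=\{1,\dots,n-1\}$, and let $W_{\mathrm{af}}$ be the affine Weyl group of type $A_{n-1}^{(1)}$. Let $J\subset I$ and $x,y\in(W^J)_{\mathrm{af}}$. Then $x\preceq y$ in $(W^J)_{\mathrm{af}}$ (semi-infinite Bruhat order) if and only if $\mathcal{Y}_i^{A_{n-1}}(x)\preceq\mathcal{Y}_i^{A_{n-1}}(y)$ in $\mathrm{CST}_{A_{n-1}}(\varpi_i)\times\mathbb{Z}$ for all $i\in I\setminus J$.
   Context: Write $[k]=\{1,\dots,k\}$ ($=\emptyset$ if $k\le0$). Let $\varepsilon_1,\dots,\varepsilon_n$ be an orthonormal basis of $\mathbb{R}^n$, $\Delta=\{\pm(\varepsilon_s-\varepsilon_t)\mid s<t\}$ with simple roots $\alpha_s=\varepsilon_s-\varepsilon_{s+1}$ ($s\in I$); roots and coroots are identified. $W=\mathfrak S_n$ permutes the $\varepsilon_s$; write $w(s)$ for the index with $w\varepsilon_s=\varepsilon_{w(s)}$. $Q^\vee=\bigoplus_{i\in I}\mathbb{Z}\alpha_i^\vee$, and $c_i(\xi)$ is the coefficient of $\alpha_i^\vee$ in $\xi\in Q^\vee$. $W_{\mathrm{af}}=W\ltimes\{t_\xi\mid\xi\in Q^\vee\}$, with $\Delta_{\mathrm{af}}=\{\alpha+m\delta\mid\alpha\in\Delta,m\in\mathbb{Z}\}$, $\Delta^+_{\mathrm{af}}=\Delta^+\sqcup\{\alpha+m\delta\mid\alpha\in\Delta,m>0\}$, $wt_\xi(\alpha+m\delta)=w\alpha+(m-\langle\xi,\alpha\rangle)\delta$,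 $r_{\alpha+m\delta}=r_\alpha t_{m\alpha^\vee}$. For $J\subset I$, with $\Delta_J=\Delta\cap\bigoplus_{j\in J}\mathbb{Z}\alpha_j$, set $(W^J)_{\mathrm{af}}=\{x\in W_{\mathrm{af}}\mid x\beta\in\Delta^+_{\mathrm{af}}\text{ for all }\beta\in(\Delta_J\cap\Delta^+)\sqcup\{\alpha+m\delta\mid\alpha\in\Delta_J,m>0\}\}$. Let $\ell^{\frac{\infty}{2}}(wt_\xi)=\ell(w)+2\langle\xi,\rho\rangle$, $\rho=\frac12\sum_{\alpha\in\Delta^+}\alpha$. The semi-infinite Bruhat order on $(W^J)_{\mathrm{af}}$ is the partial order generated by $x\prec r_\beta x$ for $\beta\in\Delta^+_{\mathrm{af}}$ with $x,r_\beta x\in(W^J)_{\mathrm{af}}$ and $\ell^{\frac{\infty}{2}}(r_\beta x)=\ell^{\frac{\infty}{2}}(x)+1$. $\mathrm{CST}_{A_{n-1}}(\varpi_i)$ is the family of $i$-element subsets $\mathsf T=\{\mathsf T(1)<\cdots<\mathsf T(i)\}$ of $[n]$. For $w\in W$ let $\mathsf T^{(i)}_w=\{w(1),\dots,w(i)\}$. Define $\mathcal Y_i^{A_{n-1}}(wt_\xi)=(\mathsf T^{(i)}_w,c_i(\xi))$. On $\mathrm{CST}_{A_{n-1}}(\varpi_i)\times\mathbb{Z}$ set $(\mathsf T,c)\preceq(\mathsf T',c')$ iff $c\le c'$ and $\mathsf T(u)\le\mathsf T'(u+c'-c)$ for all $u\in[i-c'+c]$. *)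

(* Defs.v *)
From mathcomp Require Import all_boot all_order all_fingroup all_algebra.
From Stdlib Require Import Relation_Operators ClassicalEpsilon.

Set Implicit Arguments.
Unset Strict Implicit.
Unset Printing Implicit Defensive.

Import Order.TTheory GRing.Theory Num.Theory.
Local Open Scope ring_scope.

(* Conventions.
   - Indices are shifted down by one: [n] is 'I_n and I = {1, ..., n-1} is
     'I_n.-1, so that i : 'I_n.-1 stands for the index i + 1 of I.
   - Roots, coroots and translation vectors are row vectors of integers, the
     coordinates being those in the orthonormal basis (eps s).
   - W is 'S_n.  Beware that MathComp composes permutations from left to right:
     (u * v) s = v (u s), so the product "w v" of W is (v * w)%g below. *)

Lemma ord_hi_subproof n (i : 'I_n.-1) : (i.+1 < n)%N.
Proof. by rewrite -ltn_predRL. Qed.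

Definition ord_lo n (i : 'I_n.-1) : 'I_n := widen_ord (leq_pred n) i.
Definition ord_hi n (i : 'I_n.-1) : 'I_n := Ordinal (ord_hi_subproof i).

Definition eps n (s : 'I_n) : 'rV[int]_n := delta_mx 0 s.
Definition simple_root n (i : 'I_n.-1) : 'rV[int]_n :=
  eps (ord_lo i) - eps (ord_hi i).

Definition pairing n (u v : 'rV[int]_n) : int := \sum_s u 0 s * v 0 s.

Definition wact n (w : 'S_n) (v : 'rV[int]_n) : 'rV[int]_n :=
  \row_s v 0 (w^-1%g s).

Lemma wact_eps n (w : 'S_n) (s : 'I_n) : wact w (eps s) = eps (w s).
Proof.
apply/rowP => j; rewrite !mxE !eqxx /=; congr ((_ : bool)%:R).
by apply/eqP/eqP => [<-|->]; rewrite ?permKV ?permK.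
Qed.

Lemma pairing_eps n (v : 'rV[int]_n) (s t : 'I_n) :
  pairing v (eps s - eps t) = v 0 s - v 0 t.
Proof.
have E r : \sum_k v 0 k * eps r 0 k = v 0 r.
  rewrite (bigD1 r) //= big1 => [|k /negPf kr]; rewrite mxE !eqxx.
    by rewrite mulr1 addr0.
  by rewrite kr mulr0.
rewrite -(E s) -(E t) -sumrB; apply: eq_bigr => k _.
by rewrite !mxE mulrBr.
Qed.

Lemma wact_tperm n (s t : 'I_n) (v : 'rV[int]_n) : s != t ->
  wact (tperm s t) v = v - pairing v (eps s - eps t) *: (eps s - eps t).
Proof.
move=> /negPf st; apply/rowP => j; rewrite pairing_eps !mxE tpermV !eqxx /=.
case: tpermP => [->|->|/eqP/negPf-> /eqP/negPf->]; rewrite ?eqxx ?st.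
- by rewrite subr0 mulr1 subKr.
- by rewrite eq_sym st sub0r mulrN1 opprK addrC subrK.
by rewrite subrr mulr0 subr0.
Qed.

Definition is_pos_root n (a : 'rV[int]_n) : Prop :=
  exists s t : 'I_n, (s < t)%N /\ a = eps s - eps t.
Definition is_root n (a : 'rV[int]_n) : Prop :=
  is_pos_root a \/ is_pos_root (- a).

(* Delta_J : roots in the Z-span of the simple roots indexed by J *)
Definition is_root_in n (J : {set 'I_n.-1}) (a : 'rV[int]_n) : Prop :=
  is_root a /\
  exists c : 'I_n.-1 -> int, a = \sum_(j in J) c j *: simple_root j.

Definition two_rho n : 'rV[int]_n :=
  \sum_(s < n) \sum_(t < n | (s < t)%N) (eps s - eps t).

Definition lincomb n (c : 'rV[int]_n.-1) : 'rV[int]_n :=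
  \sum_i c 0 i *: simple_root i.

Definition in_coroot_lattice n (xi : 'rV[int]_n) : Prop :=
  exists c : 'rV[int]_n.-1, xi = lincomb c.

(* c_i(xi); an arbitrary integer if xi is not in the coroot lattice *)
Definition coroot_coef n (xi : 'rV[int]_n) (i : 'I_n.-1) : int :=
  epsilon (inhabits (0 : 'rV[int]_n.-1)) (fun c => xi = lincomb c) 0 i.

Lemma sum_eps n (P : pred 'I_n) (a : 'I_n) :
  \sum_(s < n | P s) eps a 0 s = (P a)%:R.
Proof.
rewrite big_mkcond (bigD1 a) //= big1 ?addr0 => [|s /negPf sa].
  by rewrite mxE !eqxx; case: (P a).
by rewrite mxE eqxx sa; case: (P s).
Qed.

Lemma lincomb_partial_sum n (c : 'rV[int]_n.-1) (i : 'I_n.-1) :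
  \sum_(s < n | (s <= i)%N) lincomb c 0 s = c 0 i.
Proof.
transitivity (\sum_j c 0 j * ((j <= i)%N%:R - (j < i)%N%:R)).
  under eq_bigr => s _ do rewrite /lincomb summxE.
  rewrite exchange_big; apply: eq_bigr => j _ /=.
  have E s : (c 0 j *: simple_root j) 0 s =
      c 0 j * (eps (ord_lo j) 0 s - eps (ord_hi j) 0 s) by rewrite !mxE.
  under eq_bigr => s _ do rewrite E.
  rewrite -mulr_sumr big_split sumrN /=.
  by congr (_ * (_ - _)); rewrite [LHS](sum_eps (fun s : 'I_n => (s <= i)%N)).
rewrite (bigD1 i) //= leqnn ltnn subr0 mulr1 big1 ?addr0 // => j ji.
by rewrite [(j < i)%N]ltn_neqAle (ji : (j : nat) != i) subrr mulr0.
Qed.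

Lemma lincomb_inj n : injective (@lincomb n).
Proof.
move=> c d cd; apply/rowP => i.
by rewrite -(lincomb_partial_sum c) cd lincomb_partial_sum.
Qed.

Lemma coroot_coef_lincomb n (c : 'rV[int]_n.-1) (i : 'I_n.-1) :
  coroot_coef (lincomb c) i = c 0 i.
Proof.
rewrite /coroot_coef; set P := fun d => _.
have /lincomb_inj <- // : P (epsilon (inhabits 0) P).
by apply: epsilon_spec; exists c.
Qed.

(* W extended by all translations of Z^n; (w, xi) stands for w t_xi. *)
Definition ext_aff n : Type := ('S_n * 'rV[int]_n)%type.

Definition in_Waf n (x : ext_aff n) : Prop := in_coroot_lattice x.2.

(* (w t_xi) (v t_zeta) = w v t_(v^-1 xi + zeta) *)
Definition amul n (x y : ext_aff n) : ext_aff n :=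
  ((y.1 * x.1)%g, wact y.1^-1%g x.2 + y.2).

(* (a, m) stands for a + m delta. *)
Definition aff_vec n : Type := ('rV[int]_n * int)%type.

Definition aact n (x : ext_aff n) (b : aff_vec n) : aff_vec n :=
  (wact x.1 b.1, b.2 - pairing x.2 b.1).

Lemma aact_amul n (x y : ext_aff n) (b : aff_vec n) :
  aact (amul x y) b = aact x (aact y b).
Proof.
case: x y b => [w xi] [v zeta] [a m]; congr (_, _) => /=.
  by apply/rowP => j; rewrite !mxE invMg permM.
rewrite -addrA -opprD /pairing; congr (_ - _).
rewrite [X in _ = _ + X](reindex_inj (@perm_inj _ v)) -big_split /=.
by apply: eq_bigr => j _; rewrite !mxE invgK permK mulrDl addrC.
Qed.

Definition is_pos_aff_root n (b : aff_vec n) : Prop :=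
  (is_pos_root b.1 /\ b.2 = 0) \/ (is_root b.1 /\ 0 < b.2).

Definition is_pos_aff_root_in n (J : {set 'I_n.-1}) (b : aff_vec n) : Prop :=
  (is_root_in J b.1 /\ is_pos_root b.1 /\ b.2 = 0) \/
  (is_root_in J b.1 /\ 0 < b.2).

(* r_beta = r_a t_(m a^vee) for beta = a + m delta and a = eps s - eps t *)
Definition aff_refl n (s t : 'I_n) (m : int) : ext_aff n :=
  (tperm s t, m *: (eps s - eps t)).

Definition in_WJaf n (J : {set 'I_n.-1}) (x : ext_aff n) : Prop :=
  in_Waf x /\ forall b, is_pos_aff_root_in J b -> is_pos_aff_root (aact x b).

Definition simple_refl n (i : 'I_n.-1) : 'S_n := tperm (ord_lo i) (ord_hi i).

Definition has_word n (w : 'S_n) (k : nat) : bool :=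
  [exists c : k.-tuple 'I_n.-1, w == (\prod_(i <- c) simple_refl i)%g].

Lemma has_wordM n (u v : 'S_n) (k l : nat) :
  has_word u k -> has_word v l -> has_word (u * v)%g (k + l).
Proof.
move=> /existsP[c /eqP->] /existsP[d /eqP->]; apply/existsP.
by exists (cat_tuple c d); rewrite big_cat.
Qed.

Lemma has_word_simple n (i : 'I_n.-1) : has_word (simple_refl i) 1.
Proof. by apply/existsP; exists [tuple i]; rewrite big_seq1. Qed.

Lemma has_word_tperm n (s t : 'I_n) : exists k, has_word (tperm s t) k.
Proof.
wlog st : s t / (s < t)%N => [IH|].
  have [/IH//|/IH|/val_inj->] := ltngtP s t; first by rewrite tpermC.
  by exists 0%N; apply/existsP; exists [tuple]; rewrite big_nil tperm1.
have [d] := ubnP (t - s)%N; elim: d s t st => // d IH s t st le_d.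
have t1K : t.-1.+1 = t by rewrite prednK ?(leq_ltn_trans _ st).
have t1 : (t.-1 < n.-1)%N by rewrite ltn_predRL t1K.
pose i := Ordinal t1; have hi_t : ord_hi i = t by apply: val_inj.
have [lo_s|neq_s] := eqVneq (ord_lo i) s.
  by exists 1%N; rewrite -lo_s -hi_t has_word_simple.
have lt_s : (s < ord_lo i)%N.
  rewrite ltn_neqAle eq_sym (neq_s : (ord_lo i : nat) != s) /=.
  by rewrite -ltnS t1K.
have [|k Hk] := IH s (ord_lo i) lt_s.
  rewrite -ltnS (leq_trans _ le_d) // ltnS -[in X in (_ < X)%N]t1K.
  by rewrite subSn ?(ltnW lt_s).
have -> : tperm s t = (simple_refl i * tperm s (ord_lo i) * simple_refl i)%g.
  rewrite -{1}[simple_refl i]tpermV -mulgA -/(conjg _ _) tpermJ tpermL hi_t.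
  by rewrite tpermD // ?hi_t -val_eqE /= ?gtn_eqF.
by exists (1 + k + 1)%N; do ?apply: has_wordM; rewrite ?has_word_simple.
Qed.

Lemma has_word_ex n (w : 'S_n) : exists k, has_word w k.
Proof.
have [ts -> _] := prod_tpermP w; elim: ts => [|p ts [k Hk]].
  by exists 0%N; apply/existsP; exists [tuple]; rewrite !big_nil.
have [l Hl] := has_word_tperm p.1 p.2.
by exists (l + k)%N; rewrite big_cons has_wordM.
Qed.

Definition wlength n (w : 'S_n) : nat := ex_minn (has_word_ex w).

Definition si_length n (x : ext_aff n) : int :=
  (wlength x.1)%:Z + pairing x.2 (two_rho n).

Definition si_step n (J : {set 'I_n.-1}) (x y : ext_aff n) : Prop :=
  exists (s t : 'I_n) (m : int),
    [/\ is_pos_aff_root (eps s - eps t, m),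
        y = amul (aff_refl s t m) x,
        in_WJaf J x,
        in_WJaf J y
      & si_length y = si_length x + 1].

Definition si_le n (J : {set 'I_n.-1}) : ext_aff n -> ext_aff n -> Prop :=
  clos_refl_trans (ext_aff n) (si_step J).

(* CST(varpi_i), with i shifted *)
Definition CST n (i : 'I_n.-1) : Type := {T : {set 'I_n} | #|T| == i.+1}.

(* enum lists a set of ordinals in increasing order, so the entry of T at
   u : nat is T(u + 1), itself shifted down by one. *)
Definition entry n (T : {set 'I_n}) (u : nat) : nat :=
  nth 0%N [seq val s | s <- enum T] u.

Lemma sorted_enum n (T : {set 'I_n}) : sorted ltn [seq val s | s <- enum T].
Proof.
rewrite (@subseq_sorted _ ltn ltn_trans _ (iota 0 n)) ?iota_ltn_sorted //.
by rewrite -val_enum_ord map_subseq // {1}/enum_mem -enumT filter_subseq.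
Qed.

Definition column_set n (w : 'S_n) (i : 'I_n.-1) : {set 'I_n} :=
  [set w s | s : 'I_n & (s <= i)%N].

Lemma card_column_set n (w : 'S_n) (i : 'I_n.-1) : #|column_set w i| == i.+1.
Proof.
rewrite card_imset; last exact: perm_inj.
have le_in : (i.+1 <= n)%N by rewrite ltnW // ord_hi_subproof.
have inj_w : injective (widen_ord le_in) by move=> a b [/val_inj].
rewrite -[X in _ == X]card_ord -(card_imset _ inj_w).
apply/eqP/eq_card => s; rewrite inE; apply/idP/imsetP => [si|[k _ ->]].
  by exists (Ordinal (si : (s < i.+1)%N)) => //; apply: val_inj.
by rewrite /= -ltnS.
Qed.

Definition column n (w : 'S_n) (i : 'I_n.-1) : CST i :=
  exist _ (column_set w i) (card_column_set w i).

Definition Ymap n (i : 'I_n.-1) (x : ext_aff n) : CST i * int :=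
  (column x.1 i, coroot_coef x.2 i).

(* With u shifted down by one, u ranges over u < i - c' + c, where i is the
   cardinality i.+1; c <= c' makes the argument of absz nonnegative. *)
Definition CST_le n (i : 'I_n.-1) (p q : CST i * int) : Prop :=
  p.2 <= q.2 /\
  forall u : nat, u%:Z < i.+1%:Z - q.2 + p.2 ->
    (entry (val p.1) u <= entry (val q.1) (absz (u%:Z + q.2 - p.2)%R))%N.

(* Main.v *)
(* Encode x = w t_xi by its window g(s) = w(s) + n xi_s, an affine permutation,
   and put rk(c, k) = sum_{s < c} floor((k - g(s)) / n).  Then Y_i(x) <= Y_i(y)
   says exactly that rk_x(i, k) >= rk_y(i, k) for all k, x lies in (W^J)_af iff g
   is increasing of span < n on every J-block of positions, and the semi-infinite
   length is sum_{s<t} (1 + floor((g(s) - g(t)) / n)).  A reflection exchanges g(p)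
   and g(q) up to multiples of n; when it raises g at p < q, rk decreases at the
   cuts between p and q and the length grows, by exactly 1 if the raise d is < n
   and no g(r) with p < r < q lies strictly between g(p) and g(p) + d modulo n.
   This gives the forward implication.
     Conversely let rk_x >= rk_y at all cuts (ends of J-blocks), b the first cut
   where they differ and b0 the previous one.  Either the two agree at (b, k) but
   not at (b, k - 1) for some k; then take p in [b0, b) with g(p) closest below k
   modulo n, and q closest above g(p) in the first block having a residue in
   (g(p), k].  Or they differ at (b, k) for every k; then take p in [b0, b) and q
   in the next block with minimal cyclic distance.  In both cases the raise at
   (p, q) is a step in (W^J)_af that keeps rk_x >= rk_y, and one iterates until
   the ranks agree, which forces x = y. *)
Require Import Defs.
From mathcomp Require Import all_boot all_order all_fingroup all_algebra.
From mathcomp Require Import zify ring.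
From Stdlib Require Import Relation_Operators Classical.

Set Implicit Arguments.
Unset Strict Implicit.
Unset Printing Implicit Defensive.

Import Order.TTheory GRing.Theory Num.Theory.
Local Open Scope ring_scope.

(** * Comparing columns by counting entries *)

Lemma nth_lt_count (l : seq nat) (k u : nat) : sorted ltn l -> (u < size l)%N ->
  (nth 0%N l u < k)%N = (u < count (fun v => v < k)%N l)%N.
Proof.
elim: l u => // v l IH u /= path_l.
have [vk|kv] := ltnP v k.
  case: u => [//|u] /=; rewrite ltnS => /(IH _ (path_sorted path_l)) ->.
  by rewrite add1n ltnS.
have none : count (fun v => v < k)%N l = 0%N.
  apply/eqP; rewrite -leqn0 leqNgt -has_count -all_predC.
  apply/allP => v' /(allP (order_path_min ltn_trans path_l)) /=; lia.
rewrite none; case: u => [_|u] /=; first by lia.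
by rewrite ltnS => /(IH _ (path_sorted path_l)) ->; rewrite none.
Qed.

Definition count_below n (T : {set 'I_n}) k :=
  count (fun v => v < k)%N [seq val s | s <- enum T].

Lemma size_entries n (T : {set 'I_n}) : size [seq val s | s <- enum T] = #|T|.
Proof. by rewrite size_map cardE. Qed.

Lemma entry_lt n (T : {set 'I_n}) u k : (u < #|T|)%N ->
  (entry T u < k)%N = (u < count_below T k)%N.
Proof.
by move=> uT; rewrite /entry nth_lt_count ?size_entries ?sorted_enum.
Qed.

Lemma entry_lt_n n (T : {set 'I_n}) u : (u < #|T|)%N -> (entry T u < n)%N.
Proof.
rewrite -size_entries => /(mem_nth 0%N) /mapP[s _ E].
by rewrite /entry E ltn_ord.
Qed.

(** Entries and counts form a Galois pair: [entry T u < k] iff [u < count_below T k]. A failure of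
    the counts at [k] is refuted at the index [count_below T k], the first entry not below [k].
    Conversely [k = entry T' v + 1] recovers the entry inequality, and [k = 0] gives [c <= c']. *)
Lemma shifted_entries_leP n (T T' : {set 'I_n}) (m : nat) (c c' : int) :
    #|T| = m -> #|T'| = m ->
  (c <= c' /\ (forall u : nat, u%:Z < m%:Z - c' + c ->
     (entry T u <= entry T' (absz (u%:Z + c' - c)%R))%N)) <->
  (forall k, (k <= n)%N ->
     (count_below T' k)%:Z - c' <= (count_below T k)%:Z - c).
Proof.
move=> cT cT'; split=> [[le_c le_TT'] k _|le_count].
  rewrite leNgt; apply/negP => lt_count.
  have T'_le : (count_below T' k <= m)%N.
    by rewrite -cT' -size_entries count_size.
  have lt_m : (count_below T k)%:Z < m%:Z - c' + c by lia.
  have := le_TT' _ lt_m.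
  have uT : (count_below T k < #|T|)%N by lia.
  have := entry_lt k uT; rewrite ltnn => /negbT; rewrite -leqNgt => k_le.
  pose u := absz ((count_below T k)%:Z + c' - c)%R.
  have uT' : (u < #|T'|)%N by rewrite /u; lia.
  have := entry_lt k uT'.
  have -> : (u < count_below T' k)%N by rewrite /u; lia.
  by rewrite -/u; lia.
have c0 (U : {set 'I_n}) : count_below U 0 = 0%N.
  by rewrite /count_below; elim: [seq val s | s <- enum U].
have le_c : c <= c' by have := le_count 0%N isT; rewrite !c0; lia.
split=> // u lt_u; pose v := absz (u%:Z + c' - c)%R; rewrite -/v.
have vT' : (v < #|T'|)%N by rewrite /v; lia.
have uT : (u < #|T|)%N by lia.
rewrite -ltnS (entry_lt _ uT).
have := le_count _ (entry_lt_n vT').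
have := entry_lt (entry T' v).+1 vT'; rewrite ltnSn => /esym.
rewrite /v; lia.
Qed.

Section AffinePermutations.
Variable n : nat.
Hypothesis n_gt0 : (0 < n)%N.
Implicit Types (b c : nat) (z k d e m : int) (C : pred nat).
Implicit Types (g h : 'I_n -> int) (p q r s t : 'I_n).
Implicit Types (w : 'S_n) (x y : ext_aff n) (J : {set 'I_n.-1}) (i : 'I_n.-1).

(** * Floor division by n *)

Definition fl z : int := (z %/ n%:Z)%Z.
Definition md z : int := (z %% n%:Z)%Z.

Lemma fl_md z : z = fl z * n%:Z + md z.
Proof. exact: divz_eq. Qed.

Lemma md_ge0 z : 0 <= md z.
Proof. by apply: modz_ge0; lia. Qed.

Lemma md_lt z : md z < n%:Z.
Proof. by apply: ltz_pmod. Qed.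

Lemma md_bounds z : 0 <= md z < n%:Z.
Proof. by rewrite md_ge0 md_lt. Qed.

Lemma fl_uniq z e : e * n%:Z <= z < e * n%:Z + n%:Z -> fl z = e.
Proof.
move=> H; have := md_bounds z; have := fl_md z; move: (fl z) (md z) => f m ? ?.
nia.
Qed.

Lemma md_uniq z e d : 0 <= d < n%:Z -> z = e * n%:Z + d -> md z = d.
Proof.
move=> H E; have := fl_md z; rewrite (@fl_uniq z e); lia.
Qed.

Lemma flMD z e : fl (z + e * n%:Z) = fl z + e.
Proof.
by apply: fl_uniq; rewrite mulrDl; have := fl_md z; have := md_bounds z; lia.
Qed.

Lemma mdMD z e : md (z + e * n%:Z) = md z.
Proof.
apply: (@md_uniq _ (fl z + e)); first exact: md_bounds.
by rewrite mulrDl; have := fl_md z; lia.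
Qed.

Lemma md_small z : 0 <= z < n%:Z -> md z = z.
Proof. by move=> H; apply: (@md_uniq _ 0); lia. Qed.

Lemma fl_mono k z : k <= z -> fl k <= fl z.
Proof.
have := fl_md z; have := md_bounds z; have := fl_md k; have := md_bounds k.
by move: (fl z) (md z) (fl k) (md k) => *; nia.
Qed.

Lemma flN z : md z != 0 -> fl (- z) = - fl z - 1.
Proof.
by move=> H; apply: fl_uniq; have := fl_md z; have := md_bounds z; lia.
Qed.

Lemma fl_sub z d : 0 <= d <= n%:Z ->
  fl z - fl (z - d) = if md z < d then 1 else 0.
Proof.
have := fl_md z; have := md_bounds z; case: (ltP (md z) d) => H ? ? ?.
  by rewrite (@fl_uniq (z - d) (fl z - 1)); lia.
by rewrite (@fl_uniq (z - d) (fl z)); lia.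
Qed.

(** * Raising an affine permutation *)

(** These are the windows that extend to a bijection of the integers commuting with the shift by
    [n]. *)
Definition inj_mod g := forall s t, md (g s - g t) = 0 -> s = t.

(* For p < q this raises the value at p when g q + e n > g p. *)
Definition raise g p q e : 'I_n -> int := fun s =>
  if s == p then g q + e * n%:Z else if s == q then g p - e * n%:Z else g s.

(** A signed count of the values up to [k] in the progressions [g s + n Z], [s < c], each normalised
    to contribute 0 at [k = g s]. *)
Definition rk g c k : int := \sum_(s < n | (s < c)%N) fl (k - g s).

(** For values distinct modulo [n] the term of [s < t] equals [- fl (g t - g s)]: this is Shi's
    formula for the affine length with the absolute values dropped. *)
Definition inv_sum g : int :=
  \sum_(s < n) \sum_(t < n) if (s < t)%N then 1 + fl (g s - g t) else 0.

Lemma raise_l g p q e : raise g p q e p = g q + e * n%:Z.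
Proof. by rewrite /raise eqxx. Qed.

Lemma raise_r g p q e : p != q -> raise g p q e q = g p - e * n%:Z.
Proof. by rewrite /raise eq_sym eqxx => /negPf->. Qed.

Lemma raise_D g p q e r : r != p -> r != q -> raise g p q e r = g r.
Proof. by rewrite /raise => /negPf-> /negPf->. Qed.

Lemma sum_split2 (F : 'I_n -> int) p q : p != q ->
  \sum_s F s = F p + F q + \sum_(s | (s != p) && (s != q)) F s.
Proof.
move=> pq; rewrite (bigD1 p) // (bigD1 q) /= 1?eq_sym // addrA.
by congr (_ + _); apply: eq_bigl => s; rewrite andbC.
Qed.

Lemma sum2_split2 (F : 'I_n -> 'I_n -> int) p q : p != q ->
  \sum_s \sum_t F s t = F p p + F p q + F q p + F q q +
    \sum_(r | (r != p) && (r != q)) (F p r + F q r + F r p + F r q) +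
    \sum_(s | (s != p) && (s != q)) \sum_(t | (t != p) && (t != q)) F s t.
Proof.
move=> pq; rewrite (sum_split2 _ pq) !(sum_split2 (F _) pq).
have -> : \sum_(s | (s != p) && (s != q)) \sum_t F s t =
    \sum_(s | (s != p) && (s != q)) (F s p + F s q +
      \sum_(t | (t != p) && (t != q)) F s t).
  by apply: eq_bigr => s _; rewrite -(sum_split2 _ pq).
rewrite !big_split /=; ring.
Qed.

(** Only pairs meeting [p] or [q] change. For [r] outside the interval the two shifts by [e] cancel;
    for [r] between, the pairs [(p, r)] and [(r, q)] change equally, whence the factor 2. The first
    two floors come from the pair [(p, q)]. *)
Lemma inv_sum_raise g p q e d : inj_mod g -> (p < q)%N ->
  d = g q + e * n%:Z - g p ->
  inv_sum (raise g p q e) - inv_sum g = fl d - fl (- d) +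
    \sum_(r : 'I_n | (p < r < q)%N)
      (fl (g r - g p) - fl (g r - g p - d)) *+ 2.
Proof.
move=> ginj lt_pq Ed0.
have pq : p != q by rewrite -val_eqE /= ltn_eqF.
have dist s t : s != t -> md (g s - g t) != 0.
  by move=> st; apply: contra_neq st; apply: ginj.
rewrite /inv_sum !(sum2_split2 _ pq).
set S1 := \sum_(r | _) _; set S2 := \sum_(s | _) _.
set S3 := \sum_(r | _) _; set S4 := \sum_(s | _) _.
have -> : S1 = S2.
  apply: eq_bigr => s /andP[sp sq]; apply: eq_bigr => t /andP[tp tq].
  by rewrite !raise_D.
have -> : S3 = S4 + \sum_(r : 'I_n | (p < r < q)%N)
    (fl (g r - g p) - fl (g r - g p - d)) *+ 2.
  rewrite [in X in _ = _ + X]big_mkcond /=.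
  rewrite (sum_split2 (fun r => if (p < r < q)%N then _ else _) pq).
  rewrite !ltnn /= andbF !add0r -big_split /=; apply: eq_bigr => r /andP[rp rq].
  rewrite raise_l raise_r // raise_D //.
  have Ed : g r - g p - d = g r - g q + (- e) * n%:Z by lia.
  rewrite Ed flMD // {Ed}.
  have E1 : g q + e * n%:Z - g r = g q - g r + e * n%:Z by lia.
  have E2 : g p - e * n%:Z - g r = g p - g r + (- e) * n%:Z by lia.
  have E3 : g r - (g q + e * n%:Z) = g r - g q + (- e) * n%:Z by lia.
  have E4 : g r - (g p - e * n%:Z) = g r - g p + e * n%:Z by lia.
  rewrite {}E1 {}E2 {}E3 {}E4 !flMD //.
  have Np : fl (g p - g r) = - fl (g r - g p) - 1.
    by rewrite -opprB flN // dist.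
  have Nq : fl (g q - g r) = - fl (g r - g q) - 1.
    by rewrite -opprB flN // dist.
  move: rp rq; rewrite -!val_eqE /= => rp rq.
  have [rp'|pr|/eqP] := ltngtP r p; last by rewrite (negPf rp).
    have rq' := ltn_trans rp' lt_pq.
    by rewrite rq' (leq_gtF (ltnW rq')) /=; lia.
  have [rq'|qr|/eqP] := ltngtP r q; last by rewrite (negPf rq).
    by rewrite /= mulr2n Np Nq; lia.
  by rewrite /=; lia.
rewrite raise_l raise_r // !ltnn lt_pq (leq_gtF (ltnW lt_pq)).
have -> : g q + e * n%:Z - (g p - e * n%:Z) = d + e * n%:Z by lia.
have -> : g p - g q = - d + e * n%:Z by lia.
rewrite !flMD //; lia.
Qed.

(** In [inv_sum_raise] the positions in between contribute nonnegatively and the pair [(p, q)]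
    contributes at least 1. This later rules out length-increasing reflections that raise the right
    position. *)
Lemma inv_sum_lt g p q e : inj_mod g -> (p < q)%N ->
  0 < g q + e * n%:Z - g p -> inv_sum g < inv_sum (raise g p q e).
Proof.
move=> ginj lt_pq d_gt0; rewrite -subr_gt0.
have [d Ed] : exists d, d = g q + e * n%:Z - g p by eexists.
rewrite (inv_sum_raise ginj lt_pq Ed) -Ed in d_gt0 *.
apply: ltr_wpDr.
  apply: sumr_ge0 => r _; rewrite mulrn_wge0 // subr_ge0 fl_mono //; lia.
have H0 : 0 <= fl d by rewrite -(@fl_uniq 0 0) ?fl_mono //; lia.
have H1 : fl (- d) <= -1 by rewrite -(@fl_uniq (-1) (-1)) ?fl_mono //; lia.
lia.
Qed.

(** The pair [(p, q)] contributes exactly 1, and a position [r] in between contributes only if the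
    raise passes its residue. *)
Lemma inv_sum_cover g p q e : inj_mod g -> (p < q)%N ->
  0 < g q + e * n%:Z - g p < n%:Z ->
  (forall r, (p < r < q)%N -> g q + e * n%:Z - g p <= md (g r - g p)) ->
  inv_sum (raise g p q e) = inv_sum g + 1.
Proof.
move=> ginj lt_pq d_n btw; apply/eqP; rewrite addrC -subr_eq.
have [d Ed] : exists d, d = g q + e * n%:Z - g p by eexists.
rewrite (inv_sum_raise ginj lt_pq Ed) -Ed in d_n btw *.
rewrite big1 => [|r /btw]; last by rewrite fl_sub //; [case: ltP; lia | lia].
by rewrite (@fl_uniq d 0) ?(@fl_uniq (- d) (-1)) //; lia.
Qed.

(** Once both positions lie below [c], the two shifts by [e] cancel; a cut between them sees only
    the change at [p]. *)
Lemma rk_raise g p q e c k : (p < q)%N ->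
  rk (raise g p q e) c k = rk g c k +
    if (p < c <= q)%N then fl (k - (g q + e * n%:Z)) - fl (k - g p) else 0.
Proof.
move=> lt_pq; have pq : p != q by rewrite -val_eqE /= ltn_eqF.
rewrite /rk big_mkcond [in RHS]big_mkcond /= !(sum_split2 _ pq).
set S1 := \sum_(r | _) _; set S2 := \sum_(s | _) _.
have -> : S1 = S2 by apply: eq_bigr => s /andP[sp sq]; rewrite raise_D.
rewrite raise_l raise_r //.
have -> : k - (g p - e * n%:Z) = k - g p + e * n%:Z by lia.
have -> : k - (g q + e * n%:Z) = k - g q + (- e) * n%:Z by lia.
rewrite !flMD //.
have [pc|cp] := ltnP p c; have [qc|cq] := ltnP q c => //=; try lia.
Qed.

Lemma inj_mod_raise g p q e : inj_mod g -> p != q -> inj_mod (raise g p q e).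
Proof.
move=> ginj pq s t.
have E u : exists2 v : 'I_n, v = tperm p q u &
    exists f, raise g p q e u = g v + f * n%:Z.
  exists (tperm p q u) => //.
  case: tpermP => [->|->|/eqP up /eqP uq];
    rewrite ?raise_l ?raise_r ?raise_D //.
  - by exists e.
  - by exists (- e); lia.
  by exists 0; lia.
have [s' -> [f ->]] := E s; have [t' -> [f' ->]] := E t => H.
apply: (@perm_inj _ (tperm p q)); apply: ginj; rewrite -H.
rewrite -(@mdMD _ (f - f')); congr md; lia.
Qed.

(** * Existence of a raise *)

(* C is a set of cuts: c separates the positions s < c from the positions s >= c. *)
Definition same_block C s t := forall c, C c -> (c <= s)%N = (c <= t)%N.

(* Raising g at p by d = (g q - g p) mod n keeps the blocks increasing and raises
   the length by 1 (third condition), and keeps the ranks above those of h (last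
   condition). *)
Definition raisable C g h p q :=
  [/\ (p < q)%N,
      ~ same_block C p q,
      forall r, r != p ->
        same_block C r p \/ same_block C r q \/ (p < r < q)%N ->
        md (g q - g p) <= md (g r - g p)
    & forall c k, C c -> (p < c <= q)%N ->
        md (k - g p) < md (g q - g p) -> rk h c k < rk g c k].

Lemma rk0 g k : rk g 0 k = 0.
Proof. by rewrite /rk big_pred0. Qed.

Lemma rkMD g c k e :
  rk g c (k + e * n%:Z) = rk g c k + e * \sum_(s < n | (s < c)%N) 1.
Proof.
rewrite /rk mulr_sumr -big_split /=; apply: eq_bigr => s _.
by rewrite addrAC flMD // mulr1.
Qed.

Lemma rk_split g b c k : (b <= c)%N ->
  rk g c k = rk g b k + \sum_(s < n | (b <= s < c)%N) fl (k - g s).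
Proof.
move=> bc; rewrite /rk (bigID (fun s : 'I_n => (s < b)%N)) /=.
congr (_ + _); apply: eq_bigl => s; lia.
Qed.

Lemma rk_mono g b c k d : (b <= c)%N -> k <= d ->
  rk g c k - rk g b k <= rk g c d - rk g b d.
Proof.
move=> bc kd; rewrite !(rk_split _ _ bc) ![rk g b _ + _]addrC !addrK.
by apply: ler_sum => s _; apply: fl_mono => //; lia.
Qed.

Lemma md_eq0 k d : md (k - d) = 0 -> exists e, k = d + e * n%:Z.
Proof. by move=> H; exists (fl (k - d)); have := fl_md (k - d); lia. Qed.

(** Pigeonhole: [n] distinct residues modulo [n] are all of them. *)
Lemma inj_mod_surj g k : inj_mod g -> exists s, md (k - g s) = 0.
Proof.
move=> ginj.
have lt s : (absz (md (g s)) < n)%N by have := md_bounds (g s); lia.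
have f_inj : injective (fun s => Ordinal (lt s)).
  move=> s t /(congr1 val) /= E; apply: ginj.
  have := md_bounds (g s); have := md_bounds (g t).
  have := fl_md (g s); have := fl_md (g t).
  move=> Et Es *; apply: (@md_uniq _ (fl (g s) - fl (g t))); lia.
have lt_k : (absz (md k) < n)%N by have := md_bounds k; lia.
have /codomP[s /(congr1 val) /= E] :
    Ordinal lt_k \in codom (fun s => Ordinal (lt s)).
  by apply: injF_onto.
exists s; have := md_bounds (g s); have := md_bounds k.
have := fl_md (g s); have := fl_md k.
move=> Ek Es *; apply: (@md_uniq _ (fl k - fl (g s))); lia.
Qed.

Lemma rk_incr g c k : rk g c k - rk g c (k - 1) =
  \sum_(s < n | (s < c)%N) if md (k - g s) == 0 then 1 else 0.
Proof.
rewrite /rk -sumrB; apply: eq_bigr => s _.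
have -> : k - 1 - g s = k - g s - 1 by lia.
rewrite fl_sub //; have := md_bounds (k - g s).
by case: (ltP (md (k - g s)) 1); case: eqP; lia.
Qed.

Lemma inj_mod_eq g k s t : inj_mod g ->
  md (k - g s) = md (k - g t) -> s = t.
Proof.
move=> ginj E; apply: ginj.
have := fl_md (k - g s); have := fl_md (k - g t); rewrite E => Et Es.
by apply: (@md_uniq _ (fl (k - g t) - fl (k - g s))); lia.
Qed.

Lemma rk_incr_in g c k s : inj_mod g -> (s < c)%N -> md (k - g s) = 0 ->
  rk g c k - rk g c (k - 1) = 1.
Proof.
move=> ginj sc Es; rewrite rk_incr (bigD1 s) //= Es eqxx big1 ?addr0 // => t.
case/andP => _ ts; case: eqP => // Et; case/eqP: ts.
by apply: (inj_mod_eq (k := k) ginj); rewrite Es Et.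
Qed.

Lemma rk_incr_notin g c k s : inj_mod g -> (c <= s)%N -> md (k - g s) = 0 ->
  rk g c k - rk g c (k - 1) = 0.
Proof.
move=> ginj cs Es; rewrite rk_incr big1 // => t tc; case: eqP => // Et.
suff E : t = s by move: tc; rewrite E; lia.
by apply: (inj_mod_eq (k := k) ginj); rewrite Es Et.
Qed.

(** For a cut [c] between [p] and [q], no value of [g] on [[b0, c)] has its residue in [(g p, k]],
    while [h] gains there at [k]. Since [h] does not exceed [g] at [k], its rank is strictly smaller
    at the levels from [g p] up to [k]. *)
Lemma raisable_touch C g h b0 b k :
    inj_mod g -> inj_mod h -> C b0 -> C b -> C n -> (b0 < b)%N ->
    (forall c, C c -> (c <= n)%N) ->
    (forall c, C c -> (c < b)%N -> (c <= b0)%N) ->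
    (forall c d, C c -> rk h c d <= rk g c d) ->
    (forall d, rk h b0 d = rk g b0 d) ->
    rk h b k = rk g b k -> rk h b (k - 1) < rk g b (k - 1) ->
  exists p q, raisable C g h p q.
Proof.
move=> ginj hinj Cb0 Cb Cn lt_b Cle Cb_prev le_hg eq_b0 eq_k lt_k1.
(* From [k - 1] to [k] a rank grows by 0 or 1. Passing from strict inequality to equality, [h] must
   jump and [g] must not, so [v] lies beyond [b]. *)
have [u Eu] := inj_mod_surj k hinj; have [v Ev] := inj_mod_surj k ginj.
have vb : (b <= v)%N.
  rewrite leqNgt; apply/negP => vb; have := rk_incr_in ginj vb Ev.
  have [ub|bu] := ltnP u b; first by have := rk_incr_in hinj ub Eu; lia.
  by have := rk_incr_notin hinj bu Eu; lia.
have vb0 : (b0 <= v)%N by lia.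
have h_incr : rk h b k - rk h b (k - 1) = 1.
  have [ub|bu] := ltnP u b; first exact: rk_incr_in hinj ub Eu.
  have := rk_incr_notin hinj bu Eu; have := rk_incr_notin ginj vb Ev; lia.
have h_incr0 : rk h b0 k - rk h b0 (k - 1) = 0.
  by rewrite !eq_b0; apply: rk_incr_notin Ev.
have lt_b0n : (b0 < n)%N by have := Cle _ Cb; lia.
pose P := fun s : 'I_n => (b0 <= s < b)%N.
have P0 : P (Ordinal lt_b0n) by rewrite /P /= leqnn.
case: (arg_minnP (fun s => absz (md (k - g s))) P0) => p /andP[b0p pb] p_min.
have {}p_min s : (b0 <= s < b)%N -> md (k - g p) <= md (k - g s).
  move=> /p_min; have := md_bounds (k - g p).
  by have := md_bounds (k - g s); lia.
pose D := md (k - g p).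
have D_bd : 0 < D < n%:Z.
  suff : D != 0 by have := md_bounds (k - g p); rewrite -/D; lia.
  apply/eqP => D0; have E : p = v.
    by apply: (inj_mod_eq (k := k) ginj); rewrite Ev.
  by rewrite E in pb; lia.
(* Candidates for [q]: positions beyond [b] with residue cyclically in [(g p, k]]. The position [v],
   of residue [k], is one. *)
pose cand r := (b <= r)%N && (md (g r - g p) <= D).
have distv r : md (g r - g p) <= D -> md (k - g r) = D - md (g r - g p).
  move=> H; apply: (@md_uniq _ (fl (k - g p) - fl (g r - g p))).
    by have := md_bounds (g r - g p); lia.
  by have := fl_md (k - g p); have := fl_md (g r - g p); rewrite -/D; lia.
have vdist r : md (k - g r) <= D -> md (g r - g p) = D - md (k - g r).
  move=> H; apply: (@md_uniq _ (fl (k - g p) - fl (k - g r))).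
    by have := md_bounds (k - g r); lia.
  by have := fl_md (k - g p); have := fl_md (k - g r); rewrite -/D; lia.
have candv : cand v by rewrite /cand vb /= vdist Ev; lia.
have exhi : exists c, C c && [exists r, cand r && (r < c)%N].
  by exists n; rewrite Cn; apply/existsP; exists v; rewrite candv ltn_ord.
(* [hi] ends the first block that contains a candidate. *)
case: (ex_minnP exhi) => hi /andP[Chi /existsP[r0 Pr0]] hi_min.
pose P' := fun r => cand r && (r < hi)%N.
case: (@arg_minnP _ r0 P' (fun r => absz (md (g r - g p))) Pr0) => q.
case/andP=> /andP[bq qD] q_hi q_min.
have {}q_min r : cand r -> (r < hi)%N ->
    md (g q - g p) <= md (g r - g p).
  move=> c1 c2; have /q_min : P' r by rewrite /P' c1.
  have := md_bounds (g r - g p).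
  by have := md_bounds (g q - g p); lia.
have dist0 r : r != p -> md (g r - g p) != 0.
  by move=> rp; apply: contra_neq rp; apply: ginj.
have btw_lo r : r != p -> (b0 <= r < b)%N ->
    md (g q - g p) <= md (g r - g p).
  move=> rp r_b; rewrite leNgt; apply/negP => H.
  have rD : md (g r - g p) <= D by lia.
  have := distv r rD; have := p_min r r_b; rewrite -/D.
  by have := dist0 r rp; have := md_bounds (g r - g p); lia.
have btw_hi r : (b <= r < hi)%N -> md (g q - g p) <= md (g r - g p).
  case/andP=> br r_hi; rewrite leNgt; apply/negP => H.
  have cr : cand r by rewrite /cand br /=; lia.
  by have := q_min r cr r_hi; lia.
exists p, q; split; first by lia.
- by move=> /(_ b Cb); lia.
- move=> r rp [rp_block|[rq_block|r_btw]].
  + by apply: btw_lo => //; have := rp_block b Cb; have := rp_block b0 Cb0; lia.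
  + by apply: btw_hi; have := rq_block b Cb; have := rq_block hi Chi; lia.
  + have [rb|br] := ltnP r b; first by apply: btw_lo => //; lia.
    by apply: btw_hi; lia.
move=> c d Cc c_btw d_lt.
have bc : (b <= c)%N.
  by rewrite leqNgt; apply/negP => /(Cb_prev _ Cc); lia.
have no_cand r : (r < c)%N -> ~~ cand r.
  move=> rc; apply/negP => cr.
  have := hi_min c; rewrite Cc /=.
  have -> : [exists r, cand r && (r < c)%N].
    by apply/existsP; exists r; rewrite cr.
  by move/(_ isT); lia.
(* [K] and [d'] represent [k] and [d] in the period starting at [g p]; there [g p <= d' < K]. *)
have [K KE] : exists K, K = g p + D by eexists.
have [d' d'E] : exists d', d' = g p + md (d - g p) by eexists.
have EK : k = K + fl (k - g p) * n%:Z.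
  by have := fl_md (k - g p); rewrite -/D; lia.
have Ed : d = d' + fl (d - g p) * n%:Z.
  by have := fl_md (d - g p); lia.
rewrite Ed !rkMD ltrD2r.
have d'_bd : g p <= d' < K by have := md_bounds (d - g p); lia.
have b0c : (b0 <= c)%N by lia.
(* A jump of [g] between [d'] and [K] would come from a position of [[b0, b)] closer to [k] than
   [p], or from a candidate before [c]. *)
have Eg : rk g c d' - rk g b0 d' = rk g c K - rk g b0 K.
  rewrite !(rk_split g _ b0c) ![rk g b0 _ + _]addrC !addrK.
  apply: eq_bigr => s s_c; have -> : d' - g s = K - g s - (K - d') by lia.
  have := @fl_sub (K - g s) (K - d').
  have EKs : md (K - g s) = md (k - g s).
    have -> : k - g s = K - g s + fl (k - g p) * n%:Z by move: EK; lia.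
    by rewrite mdMD.
  rewrite EKs; case: (ltP (md (k - g s)) (K - d')) => [lt_s _|_ H].
    2: by have := H _; lia.
  have [sb|bs] := ltnP s b.
    by have := p_min s; rewrite -/D sb; lia.
  have sD : md (k - g s) <= D by lia.
  have /negP[] : ~~ cand s by apply: no_cand; lia.
  by rewrite /cand bs vdist //; have := md_bounds (k - g s); lia.
have Hinc c' : rk h c' K - rk h c' (K - 1) = rk h c' k - rk h c' (k - 1).
  rewrite [in RHS]EK; move: (fl _) => e.
  have -> : K + e * n%:Z - 1 = K - 1 + e * n%:Z by lia.
  by rewrite !rkMD; lia.
have leK : d' <= K - 1 by lia.
have := rk_mono h b0c leK.
have := @rk_mono h b c (K - 1) K bc; have := Hinc b; have := Hinc b0.
have := le_hg c K Cc; rewrite !eq_b0 in h_incr0 *.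
lia.
Qed.

(** With [q] in the block just after [b], the only cut between [p] and [q] is [b], where strictness
    holds at every level. *)
Lemma raisable_apart C g h b0 b :
    inj_mod g -> C b0 -> C b -> C n -> (b0 < b < n)%N ->
    (forall c, C c -> (c <= n)%N) ->
    (forall c, C c -> (c < b)%N -> (c <= b0)%N) ->
    (forall d, rk h b d < rk g b d) ->
  exists p q, raisable C g h p q.
Proof.
move=> ginj Cb0 Cb Cn /andP[lt_b b_n] Cle Cb_prev lt_hg.
have exhi : exists c, C c && (b < c)%N by exists n; rewrite Cn.
case: (ex_minnP exhi) => hi /andP[Chi b_hi] hi_min.
pose P := fun u : 'I_n * 'I_n => (b0 <= u.1 < b)%N && (b <= u.2 < hi)%N.
have P0 : P (Ordinal (ltn_trans lt_b b_n), Ordinal b_n).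
  by rewrite /P /= leqnn lt_b leqnn.
case: (arg_minnP (fun u => absz (md (g u.2 - g u.1))) P0) => -[p q] /=.
rewrite /P /= => /andP[/andP[b0p pb] /andP[bq q_hi]] u_min.
have {}u_min r s : (b0 <= r < b)%N -> (b <= s < hi)%N ->
    md (g q - g p) <= md (g s - g r).
  move=> rb sb; have := u_min (r, s); rewrite /= rb sb => /(_ isT).
  have := md_bounds (g s - g r).
  by have := md_bounds (g q - g p); lia.
have btw_lo r : r != p -> (b0 <= r < b)%N ->
    md (g q - g p) <= md (g r - g p).
  move=> rp r_b; rewrite leNgt; apply/negP => H.
  have rp0 : md (g r - g p) != 0 by apply: contra_neq rp; apply: ginj.
  (* If [g r] came before [g q] above [g p], the pair [(r, q)] would be closer than [(p, q)]. *)
  have E : md (g q - g r) = md (g q - g p) - md (g r - g p).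
    apply: (@md_uniq _ (fl (g q - g p) - fl (g r - g p))).
      have := md_bounds (g r - g p).
      by have := md_bounds (g q - g p); lia.
    by have := fl_md (g q - g p); have := fl_md (g r - g p); lia.
  have := u_min r q r_b; rewrite bq q_hi => /(_ isT); rewrite E.
  by have := md_bounds (g r - g p); lia.
have btw_hi r : (b <= r < hi)%N -> md (g q - g p) <= md (g r - g p).
  by move=> r_hi; apply: u_min => //; rewrite b0p.
exists p, q; split; first by lia.
- by move=> /(_ b Cb); lia.
- move=> r rp [rp_block|[rq_block|r_btw]].
  + by apply: btw_lo => //; have := rp_block b Cb; have := rp_block b0 Cb0; lia.
  + by apply: btw_hi; have := rq_block b Cb; have := rq_block hi Chi; lia.
  + have [rb|br] := ltnP r b; first by apply: btw_lo => //; lia.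
    by apply: btw_hi; lia.
move=> c d Cc c_btw _; suff -> : c = b by [].
apply/eqP; rewrite eqn_leq; apply/andP; split.
  rewrite leqNgt; apply/negP => bc; have := hi_min c; rewrite Cc bc.
  by move=> /(_ isT); lia.
by rewrite leqNgt; apply/negP => /(Cb_prev _ Cc); lia.
Qed.

(** Periodicity reduces equality of ranks at a cut to finitely many levels, so that a least bad cut
    can be searched for. *)
Lemma rk_eq_ord g h c :
    (forall k : 'I_n, rk h c (k : nat)%:Z = rk g c (k : nat)%:Z) ->
  forall k, rk h c k = rk g c k.
Proof.
move=> E k; have Hk := md_bounds k.
have lt_k : (absz (md k) < n)%N by lia.
rewrite (fl_md k) addrC !rkMD //; congr (_ + _).
by have := E (Ordinal lt_k) => /=; have -> : (absz (md k))%:Z = md k by lia.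
Qed.

Lemma raisable_ex C g h c0 k0 :
    inj_mod g -> inj_mod h -> C 0%N -> C n ->
    (forall c, C c -> (c <= n)%N) ->
    (forall c d, C c -> rk h c d <= rk g c d) ->
    (forall d, rk h n d = rk g n d) ->
    C c0 -> rk h c0 k0 != rk g c0 k0 ->
  exists p q, raisable C g h p q.
Proof.
move=> ginj hinj C0 Cn Cle le_hg eq_n Cc0 neq0.
pose P c := C c &&
  [exists k : 'I_n, rk h c (k : nat)%:Z != rk g c (k : nat)%:Z].
have exP : exists c, P c.
  exists c0; rewrite /P Cc0; apply: contraR neq0.
  rewrite negb_exists => /forallP E.
  by apply/eqP/rk_eq_ord => k; apply/eqP; rewrite -[_ == _]negbK E.
case: (ex_minnP exP) => b /andP[Cb /existsP[k1 neq1]] b_min.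
have b_gt0 : (0 < b)%N.
  by case: b neq1 {b_min Cb} => [|//]; rewrite !rk0 eqxx.
have b_n : (b < n)%N.
  rewrite ltn_neqAle Cle // andbT; apply/eqP => bn.
  by rewrite bn eq_n eqxx in neq1.
have exb0 : exists c, C c && (c < b)%N by exists 0%N; rewrite C0.
have ubb0 c : C c && (c < b)%N -> (c <= b)%N by case/andP=> _ /ltnW.
case: (ex_maxnP exb0 ubb0) => b0 /andP[Cb0 b0b] b0_max.
have Cb_prev c : C c -> (c < b)%N -> (c <= b0)%N.
  by move=> Cc cb; apply: b0_max; rewrite Cc.
have eq_b0 d : rk h b0 d = rk g b0 d.
  apply: rk_eq_ord => k; apply: contraTeq b0b => neq; rewrite -leqNgt b_min //.
  by rewrite /P Cb0; apply/existsP; exists k.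
have lt1 : rk h b (k1 : nat)%:Z < rk g b (k1 : nat)%:Z.
  by rewrite lt_neqAle neq1 le_hg.
have [[k2 eq2]|no_eq] := classic (exists k, rk h b k = rk g b k); last first.
  apply: (@raisable_apart C g h b0 b) => //; first by rewrite b0b.
  move=> d; rewrite lt_neqAle le_hg // andbT.
  by apply/eqP => E; apply: no_eq; exists d.
(* [a] is a translate of [k1] by a multiple of [n] that is at most [k2], so the ranks still differ
   there. Climbing from [a] to the first agreement gives the touching level. *)
have [a Ea] : exists a : int,
    a = (k1 : nat)%:Z + fl (k2 - (k1 : nat)%:Z) * n%:Z by eexists.
have lt_a : rk h b a < rk g b a by rewrite Ea !rkMD // ltrD2r.
have le_a : a <= k2.
  have := fl_md (k2 - (k1 : nat)%:Z); have := md_bounds (k2 - (k1 : nat)%:Z).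
  by rewrite Ea; lia.
have exj : exists j : nat, rk h b (a + j%:Z) == rk g b (a + j%:Z).
  exists (absz (k2 - a)); have -> : a + (absz (k2 - a))%:Z = k2 by lia.
  by rewrite eq2.
case: (ex_minnP exj) => j /eqP eq_j j_min.
have j_gt0 : (0 < j)%N.
  by case: j eq_j {j_min} => // E; rewrite addr0 in E; rewrite E ltxx in lt_a.
apply: (@raisable_touch C g h b0 b (a + j%:Z)) => //.
rewrite lt_neqAle le_hg // andbT; apply/negP => /eqP E.
have := j_min j.-1; have -> : a + j.-1%:Z = a + j%:Z - 1 by lia.
by rewrite E eqxx => /(_ isT); lia.
Qed.

(** * Blocks and (W^J)_af *)

Definition increasing_windows C g := forall s t,
  (s < t)%N -> same_block C s t -> g s < g t < g s + n%:Z.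

(** Modulo [n], no value in the blocks of [p] and [q] lies strictly between [g p] and [g q]. The
    moved values therefore pass no other value of their blocks. *)
Lemma increasing_windows_raise C g p q e :
  inj_mod g -> increasing_windows C g ->
  p != q -> ~ same_block C p q ->
  (forall r, r != p -> same_block C r p \/ same_block C r q ->
    md (g q - g p) <= md (g r - g p)) ->
  g q + e * n%:Z - g p = md (g q - g p) ->
  increasing_windows C (raise g p q e).
Proof.
move=> ginj gwin pq Npq btw Ed s t st block_st.
have dist0 r : r != p -> md (g r - g p) != 0.
  by move=> rp; apply: contra_neq rp; apply: ginj.
have distq r : r != q -> md (g r - g p) != md (g q - g p).
  move=> rq; apply: contra_neq rq => E; apply: ginj.
  apply: (@md_uniq _ (fl (g r - g p) - fl (g q - g p))); first by lia.
  by have := fl_md (g r - g p); have := fl_md (g q - g p); lia.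
have block_ts : same_block C t s by move=> c /block_st.
have near z e' : 0 <= z + e' * n%:Z < n%:Z -> md z = z + e' * n%:Z.
  by move=> H; apply: (@md_uniq _ (- e')); lia.
have d_bd := md_bounds (g q - g p).
have dq := dist0 q; rewrite eq_sym pq in dq; have {dq} d0 := dq isT.
have := gwin s t st block_st.
have [sp|sp] := eqVneq s p.
  subst s; have tp : t != p by rewrite -val_eqE /=; lia.
  have tq : t != q by apply: contra_notN Npq => /eqP <-.
  rewrite raise_l raise_D // => H.
  have := btw t tp (or_introl block_ts); have := distq t tq.
  by rewrite (near (g t - g p) 0); lia.
have [sq|sq] := eqVneq s q.
  subst s; have tq : t != q by rewrite -val_eqE /=; lia.
  have tp : t != p by apply: contra_notN Npq => /eqP <-.
  rewrite raise_r // raise_D // => H.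
  have := btw t tp (or_intror block_ts).
  have [ltn|gen] := ltP (g t - g p + e * n%:Z) n%:Z; first by lia.
  by rewrite (near (g t - g p) (e - 1)); lia.
have [tp|tp] := eqVneq t p.
  subst t; rewrite raise_l raise_D // => H.
  have := btw s sp (or_introl block_st); have := distq s sq.
  by rewrite (near (g s - g p) 1); lia.
have [tq|tq] := eqVneq t q.
  subst t; rewrite raise_r // raise_D // => H.
  have := btw s sp (or_intror block_st).
  have [ltn|gen] := ltP (g s - g p + e * n%:Z) 0; first by lia.
  by rewrite (near (g s - g p) e); lia.
by rewrite !raise_D.
Qed.

(* On a block [lo, hi), g s is the least k with
   rk g hi k - rk g lo k >= s + 1 - hi, so g is determined by its ranks. *)
Lemma increasing_windows_le C g h : C 0%N -> C n ->
  increasing_windows C g -> increasing_windows C h ->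
  (forall c d, C c -> rk h c d = rk g c d) -> forall s, h s <= g s.
Proof.
move=> C0 Cn gwin hwin eq_hg s.
have ex_lo : exists c, C c && (c <= s)%N by exists 0%N; rewrite C0.
have ub_lo c : C c && (c <= s)%N -> (c <= s)%N by case/andP.
case: (ex_maxnP ex_lo ub_lo) => lo /andP[Clo lo_s] lo_max.
have ex_hi : exists c, C c && (s < c)%N by exists n; rewrite Cn ltn_ord.
case: (ex_minnP ex_hi) => hi /andP[Chi s_hi] hi_min.
have block r : (lo <= r < hi)%N -> same_block C r s.
  move=> r_btw c Cc; have := lo_max c; have := hi_min c; rewrite Cc /=.
  by have [cs|sc] := leqP c s => [_ /(_ isT)|/(_ isT) ? _]; lia.
have lo_hi : (lo <= hi)%N by lia.
have at_s f : increasing_windows C f -> rk f hi (f s) - rk f lo (f s) =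
    \sum_(r < n | (lo <= r < hi)%N) if (r <= s)%N then 0 else - 1.
  move=> fwin; rewrite (rk_split _ _ lo_hi) addrC addKr.
  apply: eq_bigr => r /block rs; apply: fl_uniq => //.
  have [r_s|s_r|/val_inj ->] := ltngtP r s; last by lia.
    by have := fwin r s r_s rs; lia.
  by have := fwin s r s_r (fun c Cc => esym (rs c Cc)); lia.
have below_s f : increasing_windows C f ->
    rk f hi (f s - 1) - rk f lo (f s - 1) =
    \sum_(r < n | (lo <= r < hi)%N) if (r < s)%N then 0 else - 1.
  move=> fwin; rewrite (rk_split _ _ lo_hi) addrC addKr.
  apply: eq_bigr => r /block rs; apply: fl_uniq => //.
  have [r_s|s_r|/val_inj ->] := ltngtP r s; last by lia.
    by have := fwin r s r_s rs; lia.
  by have := fwin s r s_r (fun c Cc => esym (rs c Cc)); lia.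
have lt_sum : \sum_(r < n | (lo <= r < hi)%N) (if (r < s)%N then 0 else - 1) <
    \sum_(r < n | (lo <= r < hi)%N) if (r <= s)%N then 0 else - 1 :> int.
  have s_btw : (lo <= s < hi)%N by rewrite lo_s.
  rewrite !(bigD1 s s_btw) /= ltnn leqnn; apply: ltr_leD => //.
  by apply: ler_sum => r _; case: ltngtP.
rewrite leNgt; apply/negP => gh.
have gh1 : g s <= h s - 1 by lia.
have := rk_mono g lo_hi gh1.
by rewrite at_s // -!eq_hg // below_s // leNgt lt_sum.
Qed.

Definition window x s : int := (x.1 s : nat)%:Z + x.2 0 s * n%:Z.

Lemma md_ord s e : md ((s : nat)%:Z + e * n%:Z) = (s : nat)%:Z.
Proof. by rewrite mdMD // md_small //; have := ltn_ord s; lia. Qed.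

Lemma inj_mod_window x : inj_mod (window x).
Proof.
move=> s t /md_eq0[e E]; apply: (@perm_inj _ x.1); apply: val_inj => /=.
have := md_ord (x.1 s) (x.2 0 s); have := md_ord (x.1 t) (x.2 0 t + e).
rewrite -/(window x s) E /window mulrDl addrA => ->; lia.
Qed.

Lemma window_inj x y : window x =1 window y -> x = y.
Proof.
move=> E; have E1 s : x.1 s = y.1 s.
  apply: val_inj; have := md_ord (x.1 s) (x.2 0 s).
  by rewrite -/(window x s) E md_ord => -[] /esym.
have n0 : n%:Z != 0 by rewrite -lt0n.
case: x y E E1 => w xi [v zeta] E E1; congr (_, _); first exact/permP.
apply/rowP => s; apply: (mulIf n0).
by have := E s; rewrite /window /= E1 => /addrI.
Qed.

Lemma epsE s r : eps s 0 r = (r == s)%:R.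
Proof. by rewrite mxE eqxx. Qed.

(** Left multiplication acts on values, hence the reflection is indexed by [x.1 p] and [x.1 q]. The
    multiple of [n] at [p] becomes [x.2 0 p + m], which determines the exponent of the raise. *)
Lemma window_amul x p q m : p != q ->
  window (amul (aff_refl (x.1 p) (x.1 q) m) x) =1
  raise (window x) p q (x.2 0 p + m - x.2 0 q).
Proof.
move=> pq s; rewrite /window /= permM !mxE invgK !eqxx /= !(inj_eq perm_inj).
have [->|sp] := eqVneq s p.
  by rewrite tpermL raise_l (negPf pq) /=; lia.
have [->|sq] := eqVneq s q.
  by rewrite tpermR raise_r //=; lia.
by rewrite raise_D // tpermD 1?eq_sym ?(inj_eq perm_inj) //=; lia.
Qed.

Lemma is_pos_rootE (a b : 'I_n) : is_pos_root (eps a - eps b) <-> (a < b)%N.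
Proof.
split=> [[s [t [st /rowP E]]]|ab]; last by exists a, b.
have := E s; have := E t; rewrite !mxE !eqxx /=.
have -> : (t == s) = false by rewrite -val_eqE /=; lia.
have -> : (s == t) = false by rewrite -val_eqE /=; lia.
by do 4!case: eqP => //=; move=> *; subst; lia.
Qed.

(** The root encodes the pair of integers [a] and [b + m n]; as [a] and [b] differ by less than [n],
    the level decides their order unless [m = 0]. *)
Lemma is_pos_aff_rootE (a b : 'I_n) m : a != b ->
  is_pos_aff_root (eps a - eps b, m) <->
  0 < (b : nat)%:Z - (a : nat)%:Z + m * n%:Z.
Proof.
move=> ab; have := ltn_ord a; have := ltn_ord b => bn an.
have neq : (a : nat) <> b by apply/eqP.
rewrite /is_pos_aff_root /= /is_root opprB !is_pos_rootE.
split=> [[[lt_ab ->]|[_ m_gt0]]|H]; [lia|nia|].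
have [m0|m0|m0] := ltgtP m 0; first by nia.
  by right; split=> //; have [|] := ltnP a b; [left|right]; lia.
by left; split=> //; nia.
Qed.

Lemma root_lincomb s t : (s <= t)%N ->
  eps s - eps t = lincomb (\row_(i < n.-1) (s <= i < t)%N%:R).
Proof.
move=> st.
(* [E] extends [eps] to all natural indices, so that the sum can be telescoped. *)
pose E j : 'rV[int]_n := \row_r ((r : nat) == j)%:R.
have EE r : eps r = E r by apply/rowP => u; rewrite epsE mxE.
have := telescope_sumr (fun j => - E j) st; rewrite opprK addrC !EE => <-.
rewrite /lincomb.
have -> : \sum_(i < n.-1) (\row_j (s <= j < t)%N%:R) 0 i *: simple_root i =
   \sum_(i < n.-1 | (s <= i < t)%N) (- E i.+1 - - E i).
  rewrite [RHS]big_mkcond; apply: eq_bigr => i _.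
  rewrite mxE /simple_root !EE /=.
  by rewrite opprK addrC; case: ifP; rewrite ?scale1r ?scale0r.
rewrite big_geq_mkord.
rewrite (big_ord_widen_cond n.-1 (leq s) (fun j => - E j.+1 - - E j)) //.
by have := ltn_ord t; lia.
Qed.

(** The simple root [i] joins the positions [i] and [i.+1], which the cut [i.+1] separates. The cuts
    are thus 0, [n] and the [i.+1] with [i] outside [J]. *)
Definition cut J c : bool :=
  (c <= n)%N && [forall i : 'I_n.-1, (i.+1 == c) ==> (i \notin J)].

Lemma cut0 J : cut J 0.
Proof. by apply/andP; split => //; apply/forallP. Qed.

Lemma cutn J : cut J n.
Proof.
rewrite /cut leqnn; apply/forallP => i; apply/implyP => /eqP E.
by have := ltn_ord i; lia.
Qed.

Lemma cut_le J c : cut J c -> (c <= n)%N.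
Proof. by case/andP. Qed.

Lemma cutS J (i : 'I_n.-1) : cut J i.+1 = (i \notin J).
Proof.
rewrite /cut (ltnW (ord_hi_subproof i)) /=.
apply/forallP/idP => [/(_ i)|iJ j]; first by rewrite eqxx.
by apply/implyP; rewrite eqSS => /eqP/val_inj->.
Qed.

Lemma same_blockP J s t : (s < t)%N ->
  same_block (cut J) s t <-> forall i : 'I_n.-1, (s <= i < t)%N -> i \in J.
Proof.
move=> st; split=> [blk i i_btw|inJ c cut_c].
  by apply/negPn; rewrite -cutS; apply/negP => /blk; lia.
apply/idP/idP => [|ct]; first by lia.
rewrite leqNgt; apply/negP => sc.
case: c ct sc cut_c => // c ct sc.
have lt_c : (c < n.-1)%N by have := ltn_ord t; lia.
by rewrite (cutS J (Ordinal lt_c)) inJ //=; lia.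
Qed.

(** Coefficients on simple roots are unique, and those of [eps s - eps t] are 1 on [[s, t)] and 0
    elsewhere. *)
Lemma root_inP J s t : (s < t)%N ->
  is_root_in J (eps s - eps t) <-> same_block (cut J) s t.
Proof.
move=> st; rewrite same_blockP //; split=> [[_ [c]]|inJ].
  rewrite (root_lincomb (ltnW st)).
  have -> : \sum_(j in J) c j *: simple_root j =
      lincomb (\row_j if j \in J then c j else 0).
    rewrite big_mkcond; apply: eq_bigr => j _; rewrite mxE.
    by case: ifP; rewrite ?scale0r.
  move=> /(@lincomb_inj n)/rowP E i i_btw; have := E i; rewrite !mxE i_btw.
  by case: ifP.
split; first by left; exists s, t.
exists (fun i => (s <= i < t)%N%:R); rewrite (root_lincomb (ltnW st)).
rewrite [RHS]big_mkcond; apply: eq_bigr => j _; rewrite mxE.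
have [/inJ ->|_] := boolP (s <= j < t)%N; first by [].
by rewrite scale0r if_same.
Qed.

Lemma is_root_inN J (v : 'rV[int]_n) : is_root_in J (- v) -> is_root_in J v.
Proof.
case=> [rt [c E]]; split; first by move: rt; rewrite /is_root opprK; tauto.
exists (fun j => - c j); rewrite -[LHS]opprK E -sumrN.
by apply: eq_bigr => j _; rewrite scaleNr.
Qed.

Lemma aact_root x s t m : aact x (eps s - eps t, m) =
  (eps (x.1 s) - eps (x.1 t), m - (x.2 0 s - x.2 0 t)).
Proof.
rewrite /aact pairing_eps -!wact_eps; congr (_, _).
by apply/rowP => r; rewrite !mxE.
Qed.

Lemma aact_pos x s t m : s != t ->
  is_pos_aff_root (aact x (eps s - eps t, m)) <->
  0 < window x t - window x s + m * n%:Z.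
Proof.
move=> st; rewrite aact_root is_pos_aff_rootE ?(inj_eq perm_inj) //.
by rewrite /window; split; lia.
Qed.

Lemma in_Waf_amul x p q m : in_Waf x ->
  in_Waf (amul (aff_refl (x.1 p) (x.1 q) m) x).
Proof.
case=> c Ec; rewrite /in_Waf /= Ec.
have -> : wact x.1^-1 (m *: (eps (x.1 p) - eps (x.1 q))) = m *: (eps p - eps q).
  by apply/rowP => r; rewrite !mxE invgK !eqxx /= !(inj_eq perm_inj).
have [d ->] : exists d : 'rV_n.-1, m *: (eps p - eps q) = lincomb d.
  have lincombZ f (v : 'rV[int]_n.-1) : f *: lincomb v = lincomb (f *: v).
    by rewrite /lincomb scaler_sumr; apply: eq_bigr => i _; rewrite mxE scalerA.
  have [pq|qp] := leqP p q.
    by rewrite root_lincomb // lincombZ; eexists.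
  rewrite -opprB scalerN -scaleNr root_lincomb ?(ltnW qp) // lincombZ.
  by eexists.
exists (d + c); rewrite /lincomb -big_split; apply: eq_bigr => i _ /=.
by rewrite mxE scalerDl.
Qed.

(** For [s < t] in one block, the root [eps s - eps t] at level 0 gives the lower bound on
    [window x t], and its negative at level 1 the upper one. These two imply positivity at all other
    levels. *)
Lemma in_WJafP J x :
  in_WJaf J x <-> in_Waf x /\ increasing_windows (cut J) (window x).
Proof.
split=> -[Wx H].
  split=> // s t st blk.
  have neq_st : s != t by rewrite -val_eqE /= ltn_eqF.
  have Jst := (root_inP J st).2 blk.
  have up : 0 < window x t - window x s + 0 * n%:Z.
    by apply/(aact_pos _ _ neq_st)/H; left; do 2?split=> //; exists s, t.
  have : 0 < window x s - window x t + 1 * n%:Z.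
    rewrite eq_sym in neq_st; apply/(aact_pos _ _ neq_st)/H; right; split=> //=.
    by apply: is_root_inN; rewrite opprB.
  by move: up; lia.
split=> // -[v m] [] /= [Jv]; [case=> -[s [t [st Ev]]] m0|move=> m_gt0].
  have neq_st : s != t by rewrite -val_eqE /= ltn_eqF.
  rewrite Ev in Jv *; apply/aact_pos => //; rewrite m0.
  by have := H s t st ((root_inP J st).1 Jv); lia.
have [[[s [t [st Ev]]]|[s [t [st Ev]]]] _] := Jv.
  have neq_st : s != t by rewrite -val_eqE /= ltn_eqF.
  rewrite Ev in Jv *; apply/aact_pos => //.
  by have := H s t st ((root_inP J st).1 Jv); have := n_gt0; nia.
have neq_st : t != s by rewrite -val_eqE /= gtn_eqF.
have Ev' : v = eps t - eps s by rewrite -opprB -Ev opprK.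
rewrite Ev' -opprB in Jv; rewrite Ev'; apply/aact_pos => //.
by have := H s t st ((root_inP J st).1 (is_root_inN Jv)); have := n_gt0; nia.
Qed.

Lemma eq_inv_sum (g h : 'I_n -> int) : g =1 h -> inv_sum g = inv_sum h.
Proof.
by move=> E; apply: eq_bigr => s _; apply: eq_bigr => t _; rewrite !E.
Qed.

Lemma eq_rk (g h : 'I_n -> int) c k : g =1 h -> rk g c k = rk h c k.
Proof. by move=> E; apply: eq_bigr => s _; rewrite E. Qed.

(** * Length *)

Definition perm_window w s : int := (w s : nat)%:Z.

Lemma perm_windowE w : perm_window w =1 window (w, 0).
Proof. by move=> s; rewrite /window /= mxE mul0r addr0. Qed.

Lemma inj_mod_perm_window w : inj_mod (perm_window w).
Proof. by move=> s t; rewrite !perm_windowE; apply: inj_mod_window. Qed.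

Lemma inv_sum_perm_ge0 w : 0 <= inv_sum (perm_window w).
Proof.
apply: sumr_ge0 => s _; apply: sumr_ge0 => t _; case: ifP => // _.
have : fl (- 1 * n%:Z) <= fl (perm_window w s - perm_window w t).
  by apply: fl_mono => //; have := ltn_ord (w t); rewrite /perm_window; lia.
by rewrite -[- 1 * _]add0r flMD // (@fl_uniq 0 0); lia.
Qed.

(** In this product [simple_refl i] acts first, hence on positions: it is a raise with [e = 0] at
    adjacent positions, with nothing in between. *)
Lemma inv_sum_simple (i : 'I_n.-1) w : (w (ord_lo i) < w (ord_hi i))%N ->
  inv_sum (perm_window (simple_refl i * w)%g) = inv_sum (perm_window w) + 1.
Proof.
move=> asc; have lt_lh : (ord_lo i < ord_hi i)%N by [].
have neq_lh : ord_lo i != ord_hi i by rewrite -val_eqE /= ltn_eqF.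
have := ltn_ord (w (ord_hi i)) => hi_n.
rewrite -(@inv_sum_cover _ (ord_lo i) (ord_hi i) 0) //.
- apply: eq_inv_sum => s; rewrite /perm_window permM.
  have [->|sl] := eqVneq s (ord_lo i).
    by rewrite tpermL raise_l mul0r addr0.
  have [->|sh] := eqVneq s (ord_hi i).
    by rewrite tpermR raise_r // mul0r subr0.
  by rewrite tpermD 1?eq_sym // raise_D.
- exact: inj_mod_perm_window.
- by rewrite mul0r /perm_window; lia.
by move=> r /=; lia.
Qed.

Lemma inv_sum_simple_le (i : 'I_n.-1) w :
  inv_sum (perm_window (simple_refl i * w)%g) <= inv_sum (perm_window w) + 1.
Proof.
have [asc|desc] := ltnP (w (ord_lo i)) (w (ord_hi i)).
  by rewrite inv_sum_simple.
have neq_w : w (ord_lo i) != w (ord_hi i).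
  by rewrite (inj_eq perm_inj) -val_eqE /= ltn_eqF.
have := @inv_sum_simple i (simple_refl i * w)%g.
rewrite mulgA tperm2 mul1g !permM tpermL tpermR => ->; first by lia.
by rewrite ltn_neqAle desc andbT eq_sym.
Qed.

Lemma inv_sum1 : inv_sum (perm_window (1%g : 'S_n)) = 0.
Proof.
apply: big1 => s _; apply: big1 => t _; case: ifP => // st.
rewrite /perm_window !perm1 (@fl_uniq _ (-1)) //.
by have := ltn_ord t; lia.
Qed.

Lemma increasing_perm_id w :
  (forall i : 'I_n.-1, (w (ord_lo i) < w (ord_hi i))%N) -> w = 1%g.
Proof.
move=> asc.
have mono (d : nat) : forall s t, (s + d.+1)%N = t -> (w s < w t)%N.
  elim: d => [|d IH] s t E; have lt_s : (s < n.-1)%N by have := ltn_ord t; lia.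
    have := asc (Ordinal lt_s).
    have -> : ord_lo (Ordinal lt_s) = s by apply: val_inj.
    by have -> : ord_hi (Ordinal lt_s) = t by apply: val_inj => /=; lia.
  have := asc (Ordinal lt_s).
  have -> : ord_lo (Ordinal lt_s) = s by apply: val_inj.
  by move=> /ltn_trans; apply; apply: IH => /=; lia.
have {}mono s t : (s < t)%N -> (w s < w t)%N.
  by move=> st; apply: (mono (t - s).-1); lia.
have mono_eq s t : (w s < w t)%N = (s < t)%N.
  have [/mono //|/mono|/val_inj ->] := ltngtP s t; last by rewrite ltnn.
  by move=> ts; rewrite ltnNge ltnW.
have count_lt s : (\sum_(u < n | (u < s)%N) 1 = s)%N.
  by rewrite -(big_ord_widen n (fun=> 1%N)) ?sum1_card ?card_ord // ltnW.
apply/permP => s; rewrite perm1; apply: val_inj => /=.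
(* A value is the number of values below it, and [w] preserves this number. *)
rewrite -[LHS]count_lt -[RHS]count_lt (reindex_inj (@perm_inj _ w)).
by apply: eq_bigl => u; rewrite mono_eq.
Qed.

(* Induction on the number of inversions: cancel a descent of w. *)
Lemma has_word_inv_sum w : has_word w (absz (inv_sum (perm_window w))).
Proof.
have [N] := ubnP (absz (inv_sum (perm_window w))); elim: N w => // N IH w lt_N.
have [/forallP asc|] := boolP
    [forall i : 'I_n.-1, (w (ord_lo i) < w (ord_hi i))%N].
  rewrite (increasing_perm_id asc) inv_sum1.
  by apply/existsP; exists [tuple]; rewrite big_nil.
rewrite negb_forall => /existsP[i]; rewrite -leqNgt => desc.
have neq_w : w (ord_lo i) != w (ord_hi i).
  by rewrite (inj_eq perm_inj) -val_eqE /= ltn_eqF.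
pose v := (simple_refl i * w)%g.
have Ew : w = (simple_refl i * v)%g by rewrite /v mulgA tperm2 mul1g.
have Einv : inv_sum (perm_window w) = inv_sum (perm_window v) + 1.
  rewrite [in LHS]Ew inv_sum_simple // /v !permM tpermL tpermR.
  by rewrite ltn_neqAle desc andbT eq_sym.
have v_ge0 := inv_sum_perm_ge0 v.
have -> : absz (inv_sum (perm_window w)) =
    (1 + absz (inv_sum (perm_window v)))%N.
  by rewrite Einv; lia.
rewrite Ew; apply: has_wordM; first exact: has_word_simple.
by apply: IH; move: lt_N; rewrite Einv; lia.
Qed.

(** [has_word_inv_sum] supplies a word of this length; each letter of any word adds at most one
    inversion. *)
Lemma wlengthE w : (wlength w)%:Z = inv_sum (perm_window w).
Proof.
have ge0 := inv_sum_perm_ge0 w.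
rewrite /wlength; case: ex_minnP => k /existsP[c /eqP Ew].
move=> /(_ _ (has_word_inv_sum w)) le_k; apply/eqP; rewrite eq_le.
apply/andP; split; first by lia.
rewrite -(size_tuple c) {}Ew {le_k ge0}.
elim: (tval c) => [|i l IH]; first by rewrite big_nil inv_sum1.
rewrite big_cons /=; apply: le_trans (inv_sum_simple_le _ _) _.
by rewrite -addn1 PoszD lerD2r.
Qed.

(** Pairing with [two_rho] gives a difference of translation coordinates for each [s < t], exactly
    the shift of that pair's floor. *)
Lemma si_lengthE x : si_length x = inv_sum (window x).
Proof.
rewrite /si_length wlengthE.
have -> : pairing x.2 (two_rho n) =
    \sum_(s < n) \sum_(t < n) if (s < t)%N then x.2 0 s - x.2 0 t else 0.
  rewrite /pairing /two_rho.
  transitivity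
    (\sum_(s < n) \sum_(t < n | (s < t)%N) pairing x.2 (eps s - eps t)).
    under eq_bigr => u _ do rewrite summxE mulr_sumr.
    rewrite exchange_big; apply: eq_bigr => s _ /=.
    under eq_bigr => u _ do rewrite summxE mulr_sumr.
    by rewrite exchange_big.
  apply: eq_bigr => s _; rewrite big_mkcond; apply: eq_bigr => t _.
  by rewrite pairing_eps.
rewrite -big_split; apply: eq_bigr => s _; rewrite -big_split.
apply: eq_bigr => t _ /=; case: ifP => // _.
rewrite /window /perm_window.
have -> : (x.1 s : nat)%:Z + x.2 0 s * n%:Z -
    ((x.1 t : nat)%:Z + x.2 0 t * n%:Z) =
  (x.1 s : nat)%:Z - (x.1 t : nat)%:Z + (x.2 0 s - x.2 0 t) * n%:Z by lia.
by rewrite flMD //=; lia.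
Qed.

(** * Ranks and columns *)

Lemma count_below_column w i (k : nat) : (count_below (column_set w i) k)%:Z =
  \sum_(s < n | (s < i.+1)%N) if (w s < k)%N then 1 else 0.
Proof.
rewrite /count_below count_map -sum1_count big_enum_cond /=.
rewrite (reindex_inj (@perm_inj _ w)) /= -natz natr_sum -big_mkcondr /=.
apply: eq_bigl => s; rewrite (mem_imset _ _ (@perm_inj _ w)) inE ltnS.
by [].
Qed.

Lemma sum_in_Waf x : in_Waf x -> \sum_s x.2 0 s = 0.
Proof.
case=> c ->; under eq_bigr => s _ do rewrite summxE.
rewrite exchange_big big1 //= => i _.
have E s : (c 0 i *: simple_root i) 0 s =
    c 0 i * (eps (ord_lo i) 0 s - eps (ord_hi i) 0 s) by rewrite !mxE.
under eq_bigr => s _ do rewrite E.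
rewrite -mulr_sumr sumrB.
by rewrite !(sum_eps xpredT) subrr mulr0.
Qed.

(** Every residue occurs once and the translation coordinates sum to 0, so the rank at the cut [n]
    is the same for all [x]. *)
Lemma rk_window_n x d : in_Waf x ->
  rk (window x) n d = \sum_(s < n) fl (d - (s : nat)%:Z).
Proof.
move=> Wx; rewrite [RHS](reindex_inj (@perm_inj _ x.1)) /=.
transitivity (\sum_s (fl (d - (x.1 s : nat)%:Z) + - x.2 0 s)).
  apply: eq_big => s; first exact: ltn_ord.
  by move=> _; rewrite -flMD //; congr (fl _); rewrite /window; lia.
by rewrite big_split /= sumrN sum_in_Waf // oppr0 addr0.
Qed.

(** For these [k] the floor at [s] is [- x.2 0 s], less 1 when [x.1 s > k]; the partial sum of the
    coordinates is the coroot coefficient. [count_below] is strict, hence [k.+1]. *)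
Lemma rk_window_nat x i (k : nat) : (k < n)%N -> in_Waf x ->
  rk (window x) i.+1 k%:Z =
  (count_below (column_set x.1 i) k.+1)%:Z - coroot_coef x.2 i -
  \sum_(s < n | (s < i.+1)%N) 1.
Proof.
move=> kn [c Ec]; rewrite Ec coroot_coef_lincomb -lincomb_partial_sum -Ec.
have -> : \sum_(s < n | (s <= i)%N) x.2 0 s =
    \sum_(s < n | (s < i.+1)%N) x.2 0 s.
  by apply: eq_bigl => s; rewrite ltnS.
rewrite count_below_column.  rewrite -!sumrB; apply: eq_bigr => s _.
have -> : k%:Z - window x s = k%:Z - (x.1 s : nat)%:Z + (- x.2 0 s) * n%:Z.
  by rewrite /window; lia.
have x1n := ltn_ord (x.1 s); rewrite flMD //.
case: ifP => xk; first by rewrite (@fl_uniq _ 0); lia.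
by rewrite (@fl_uniq _ (-1)); lia.
Qed.

Lemma CST_leP x y i : in_Waf x -> in_Waf y ->
  CST_le (Ymap i x) (Ymap i y) <->
  (forall d, rk (window y) i.+1 d <= rk (window x) i.+1 d).
Proof.
move=> Wx Wy.
have card_col w : #|column_set w i| = i.+1 by apply/eqP/card_column_set.
have full w : (count_below (column_set w i) n)%:Z = (i.+1)%:Z.
  rewrite -(card_col w) -size_entries; congr (_%:Z); apply/eqP.
  by rewrite /count_below -all_count; apply/allP => v /mapP[s _ ->] /=.
have none w : count_below (column_set w i) 0 = 0%N.
  by rewrite /count_below; elim: [seq val s | s <- _].
rewrite /CST_le /=.
rewrite (shifted_entries_leP _ _ (card_col _) (card_col _)).
split=> [H d|H [|k] kn].
- have d_bd := md_bounds d.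
  have kn : (absz (md d) < n)%N by lia.
  rewrite (fl_md d) addrC !rkMD // lerD2r.
  have -> : md d = (absz (md d))%:Z by lia.
  by rewrite !rk_window_nat // lerD2r; apply: H.
(* The count condition at 0 compares only the coroot coefficients. So does the one at [n], where
   both columns are exhausted. *)
- have := H (n.-1)%:Z; have n1 : (n.-1 < n)%N by lia.
  by rewrite !rk_window_nat // !prednK // !full lerD2r !none; lia.
- by have := H k%:Z; rewrite !rk_window_nat // lerD2r.
Qed.

(** * The semi-infinite order *)

Lemma root_neq s t m : is_pos_aff_root (eps s - eps t, m) -> s != t.
Proof.
move=> H; apply/eqP => st; move: H.
rewrite st /is_pos_aff_root /= /is_root opprB.
have N : ~ is_pos_root (eps t - eps t) by move/is_pos_rootE; rewrite ltnn.
by case=> [[]|[[]]].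
Qed.

(** Positivity of the affine root says that the value at [p] is raised. If [p < q], ranks can only
    drop; the growth of the length excludes [q < p]. *)
Lemma si_step_rk J x y : si_step J x y ->
  forall c d, rk (window y) c d <= rk (window x) c d.
Proof.
case=> a [b [m [pos -> _ _]]]; rewrite !si_lengthE // => +.
have ab := root_neq pos; move: pos; rewrite is_pos_aff_rootE //.
rewrite -(permKV x.1 a) -(permKV x.1 b) in ab *.
move: (x.1^-1%g a) (x.1^-1%g b) ab => p q.
rewrite (inj_eq perm_inj) => pq d_gt0.
pose e := x.2 0 p + m - x.2 0 q.
have gap : 0 < window x q + e * n%:Z - window x p by rewrite /window /e; lia.
have Ey := window_amul x m pq; rewrite (eq_inv_sum Ey) -/e => len c d.
rewrite (eq_rk _ _ Ey).
have [lt_pq|lt_qp|/val_inj pq0] := ltngtP p q; last by rewrite pq0 eqxx in pq.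
  rewrite rk_raise //; case: ifP => _; last by rewrite addr0.
  by rewrite gerDl subr_le0 fl_mono //; lia.
(* Undoing the reflection raises the left position [q], so [x] would be longer than [y]. *)
have qp : q != p by rewrite eq_sym.
set y' := raise _ _ _ _ in len *.
have Ex : window x =1 raise y' q p (- e).
  move=> s; have [->|sq] := eqVneq s q.
    by rewrite raise_l /y' raise_l; lia.
  have [->|sp] := eqVneq s p; first by rewrite raise_r // /y' raise_r //; lia.
  by rewrite raise_D // /y' raise_D.
have y'inj : inj_mod y' by apply: inj_mod_raise => //; apply: inj_mod_window.
have : inv_sum y' < inv_sum (raise y' q p (- e)).
  by apply: inv_sum_lt => //; rewrite /y' raise_l raise_r //; lia.
by rewrite -(eq_inv_sum Ex) len; lia.
Qed.

Lemma si_le_rk J x y : si_le J x y ->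
  forall c d, rk (window y) c d <= rk (window x) c d.
Proof.
elim=> // [{}x {}y /si_step_rk //|{}x z {}y _ Hxz _ Hzy c d].
exact: le_trans (Hzy c d) (Hxz c d).
Qed.

(** The decreasing measure for building a chain from [x] to [y]; restricting to one period of levels
    keeps the sum finite. *)
Definition rk_gap J x y : nat :=
  (\sum_(u : 'I_n.+1 * 'I_n | cut J u.1)
     absz (rk (window x) u.1 (u.2 : nat)%:Z -
           rk (window y) u.1 (u.2 : nat)%:Z))%N.

Lemma raisable_step J x y p q : in_WJaf J x ->
    raisable (cut J) (window x) (window y) p q ->
    (forall c d, cut J c -> rk (window y) c d <= rk (window x) c d) ->
  exists x', [/\ si_step J x x', (rk_gap J x' y < rk_gap J x y)%N
    & forall c d, cut J c -> rk (window y) c d <= rk (window x') c d].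
Proof.
move=> WJx [lt_pq Npq btw lt_rk] le_rk.
have [Wx incx] := (in_WJafP J x).1 WJx.
have xinj := inj_mod_window (x := x).
have pq : p != q by rewrite -val_eqE /= ltn_eqF.
have x_pq : x.1 p != x.1 q by rewrite (inj_eq perm_inj).
have neq_v : (x.1 p : nat) <> x.1 q by apply/eqP.
have pn := ltn_ord (x.1 p); have qn := ltn_ord (x.1 q).
(* The level for which the raise lies strictly between 0 and [n]. *)
pose m : int := if (x.1 p < x.1 q)%N then 0 else 1.
pose e := x.2 0 p + m - x.2 0 q.
have Ed : window x q + e * n%:Z - window x p =
    (x.1 q : nat)%:Z - (x.1 p : nat)%:Z + m * n%:Z by rewrite /window /e; lia.
have d_bd : 0 < window x q + e * n%:Z - window x p < n%:Z.
  by rewrite Ed /m; case: ltnP; lia.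
have Emd : window x q + e * n%:Z - window x p = md (window x q - window x p).
  by symmetry; apply: (@md_uniq _ (- e)); lia.
pose x' := amul (aff_refl (x.1 p) (x.1 q) m) x.
have Ex' : window x' =1 raise (window x) p q e by apply: window_amul.
(* A raise by less than [n] lowers the rank by exactly 1, at the separating cuts and at residues
   cyclically in [[g p, g q)]. *)
have Erk c d : rk (window x') c d = rk (window x) c d -
    if (p < c <= q)%N && (md (d - window x p) < md (window x q - window x p))
    then 1 else 0.
  rewrite (eq_rk _ _ Ex') rk_raise //; congr (_ + _).
  case: ifP => _ /=; last by rewrite oppr0.
  rewrite -(@fl_sub _ _ (_ : 0 <= _ <= n%:Z)) -?Emd; last by lia.
  by rewrite opprB; congr (fl _ - _); lia.
have pos : is_pos_aff_root (eps (x.1 p) - eps (x.1 q), m).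
  by apply/is_pos_aff_rootE => //; rewrite -Ed; case/andP: d_bd.
have WJx' : in_WJaf J x'.
  apply/in_WJafP => //; split; first exact: in_Waf_amul.
  have : increasing_windows (cut J) (raise (window x) p q e).
    apply: increasing_windows_raise => // r rp r_blk; apply: btw => //.
    by case: r_blk; [left | right; left].
  by move=> H s t st blk; rewrite !Ex'; apply: H.
have le_rk' c d : cut J c ->
    rk (window y) c d <= rk (window x') c d <= rk (window x) c d.
  move=> Jc; rewrite Erk; case: ifP => [/andP[c_btw d_lt]|_].
    by have := lt_rk c d Jc c_btw d_lt; lia.
  by have := le_rk c d Jc; lia.
exists x'; split.
- exists (x.1 p), (x.1 q), m; split=> //; rewrite !si_lengthE //.
  rewrite (eq_inv_sum Ex') inv_sum_cover // => r r_btw; rewrite Emd.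
  apply: btw; first by rewrite -val_eqE /=; lia.
  by right; right.
- have [c [Jc c_btw]] : exists c, cut J c /\ (p < c <= q)%N.
    apply: NNPP => N; apply: Npq => c Jc; apply/idP/idP; first by lia.
    move=> cq; rewrite leqNgt; apply/negP => pc.
    by apply: N; exists c; rewrite pc.
  have c_n : (c < n.+1)%N by have := cut_le Jc; lia.
  have at_p : md ((x.1 p : nat)%:Z - window x p) = 0.
    by apply: (@md_uniq _ (- x.2 0 p)); rewrite /window; lia.
  (* [x.1 p] is the residue of the value at [p], a level where the rank at [c] drops; this term
     makes the gap strictly smaller. *)
  pose u0 : 'I_n.+1 * 'I_n := (Ordinal c_n, x.1 p).
  rewrite /rk_gap (bigD1 u0) //= [ltnRHS](bigD1 u0) //= -addSn.
  apply: leq_add; last first.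
    apply: leq_sum => u /andP[Ju _].
    by have := le_rk' u.1 (u.2 : nat)%:Z Ju; lia.
  have lt0 : md ((x.1 p : nat)%:Z - window x p) < md (window x q - window x p).
    by rewrite at_p -Emd; case/andP: d_bd.
  have := lt_rk c (x.1 p : nat)%:Z Jc c_btw lt0.
  by rewrite Erk c_btw lt0 /=; lia.
by move=> c d Jc; case/andP: (le_rk' c d Jc).
Qed.

Lemma rk_si_le J x y : in_WJaf J x -> in_WJaf J y ->
    (forall c d, cut J c -> rk (window y) c d <= rk (window x) c d) ->
  si_le J x y.
Proof.
move=> WJx WJy; have [N] := ubnP (rk_gap J x y).
have [Wy incy] := (in_WJafP J y).1 WJy.
elim: N x WJx => // N IH x WJx lt_N le_rk.
have [Wx incx] := (in_WJafP J x).1 WJx.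
have [eq_rk_xy|] := classic (forall c d, cut J c ->
    rk (window y) c d = rk (window x) c d).
  suff -> : x = y by apply: rt_refl.
  apply: window_inj => // s; apply/eqP; rewrite eq_le.
  rewrite (increasing_windows_le (cut0 J) (cutn J) incx incy) //.
  rewrite andbT.
  rewrite (increasing_windows_le (cut0 J) (cutn J) incy incx) //.
  by move=> c d Jc; rewrite eq_rk_xy.
move=> neq; have [c [d [Jc neq_cd]]] : exists c d, cut J c /\
    rk (window y) c d != rk (window x) c d.
  apply: NNPP => none; apply: neq => c d Jc; apply/eqP; apply: contra_notT none.
  by move=> neq; exists c, d.
have [p [q rpq]] : exists p q, raisable (cut J) (window x) (window y) p q.
  apply: (@raisable_ex (cut J) (window x) (window y) c d) => //.
  - exact: inj_mod_window.
  - exact: inj_mod_window.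
  - exact: cut0.
  - exact: cutn.
  - exact: cut_le.
  - by move=> d'; rewrite !rk_window_n.
have [x' [step lt_gap le_rk']] := raisable_step WJx rpq le_rk.
apply: rt_trans (rt_step _ _ _ _ step) _; apply: IH => //.
  by case: step => ? [? [? []]].
by lia.
Qed.

End AffinePermutations.

Theorem theorem4p9 (n : nat) (hn : (2 <= n)%N) (J : {set 'I_n.-1})
    (x y : ext_aff n) (hx : in_WJaf J x) (hy : in_WJaf J y) :
  si_le J x y <->
  (forall i : 'I_n.-1, i \notin J -> CST_le (Ymap i x) (Ymap i y)).
Proof.
have n_gt0 : (0 < n)%N := ltnW hn.
have [Wx Wy] : in_Waf x /\ in_Waf y by split; [case: hx | case: hy].
split=> [le_xy i _|le_Y].
  by apply/(CST_leP n_gt0 _ Wx Wy) => d; apply: si_le_rk le_xy _ _.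
(* At the cuts 0 and [n] the ranks coincide; every other cut is [i.+1] with [i] outside [J]. *)
apply: rk_si_le => // -[|c] d Jc; first by rewrite !rk0.
have [lt_c|ge_c] := ltnP c n.-1.
  have := Jc; rewrite (cutS J (Ordinal lt_c)) => /le_Y.
  by move/(CST_leP n_gt0 _ Wx Wy); apply.
have -> : c.+1 = n by have := cut_le Jc; lia.
by rewrite !rk_window_n.
Qed.
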